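(* Let $\alpha>0$ and let $f:[1,\infty)\to\mathbb{R}$ be non-decreasing, unbounded and continuous with $f(1)>0$. For real $1\le x<y$ set $w(x,y)=x^{-\alpha}f(y/x)$, and for a strictly increasing sequence of real numbers $P=(1=a_0,a_1,a_2,\ldots)$ set $w(P)=\sum_{k=0}^\infty w(a_k,a_{k+1})$. Let $g(t)=\dfrac{t^\alpha f(t)}{t^\alpha-1}$ for $t>1$. Then there is $q>1$ minimizing $g$ on $(1,\infty)$, and for such $q$, every strictly increasing real sequence $P$ with $a_0=1$ satisfies \[ w(P)\ge \frac{q^\alpha f(q)}{q^\alpha-1}, \] with equality for $P=(1,q,q^2,q^3,\ldots)$. *)

(* Defs.v *)
From HB Require Import structures.
From mathcomp Require Export all_boot all_order all_algebra.
From mathcomp Require Export all_classical all_reals all_analysis.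
Export Order.TTheory GRing.Theory Num.Theory.
Export numFieldNormedType.Exports.

Set Implicit Arguments.
Unset Strict Implicit.
Unset Printing Implicit Defensive.

Local Open Scope classical_set_scope.
Local Open Scope ring_scope.

Definition weight (R : realType) (alpha : R) (f : R -> R) (x y : R) : R :=
  x `^ (- alpha) * f (y / x).

(* Extended-real valued: the series may diverge to +oo. *)
Definition seq_weight (R : realType) (alpha : R) (f : R -> R) (a : nat -> R) :
    \bar R :=
  (\sum_(0 <= k <oo) (weight alpha f (a k) (a k.+1))%:E)%E.

Definition gfun (R : realType) (alpha : R) (f : R -> R) (t : R) : R :=
  t `^ alpha * f t / (t `^ alpha - 1).

Definition minimizes_gfun (R : realType) (alpha : R) (f : R -> R) (q : R) : Prop :=
  1 < q /\ forall t : R, 1 < t -> gfun alpha f q <= gfun alpha f t.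

(* Main.v *)
Require Import Defs.
From mathcomp Require Import ring lra.

(* Writing [t = y / x], the inequality [g q <= g t] says
   [w(x, y) >= g q * (x ^ -alpha - y ^ -alpha)], so partial weights telescope:
   [S_n >= g q * (1 - a_n ^ -alpha)].  On the other hand each of the first [n]
   terms is at least [a_n ^ -alpha * f 1], so [S_n >= n * a_n ^ -alpha * f 1].
   The second bound forces [a_n ^ -alpha] to [0] whenever the total weight is
   finite, whether or not [a] is bounded, and the first one then gives
   [g q <= w(P)].  A minimizer exists because [g] is continuous and exceeds
   [g 2] both close to [1] and far out. *)

Local Open Scope classical_set_scope.
Local Open Scope ring_scope.

Lemma powR_gt1 (R : realType) (alpha t : R) :
  0 < alpha -> 1 < t -> 1 < t `^ alpha.
Proof.
move=> alpha_gt0 t_gt1; rewrite -[X in X < _](congr1 (@^~ alpha) (powR1 R)).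
by apply: gt0_ltr_powR; rewrite // nnegrE; lra.
Qed.

Lemma within_continuous_gfun (R : realType) (alpha : R) (f : R -> R) (c d : R) :
  0 < alpha -> 1 < c -> {within `[1, +oo[, continuous f} ->
  {within `[c, d], continuous (gfun alpha f)}.
Proof.
move=> alpha_gt0 c_gt1 f_cont.
have f_cont' : {within `[c, d], continuous f}.
  apply: continuous_subspaceW f_cont => x /=; rewrite !in_itv/= => /andP[cx _].
  by rewrite andbT; lra.
have p_cont : {within `[c, d], continuous (fun t : R => t `^ alpha)}.
  apply: derivable_within_continuous => x; rewrite in_itv/= => /andP[cx _].
  by apply: derivable_powR; rewrite in_itv/= andbT; lra.
rewrite continuous_subspace_in => x; rewrite inE/= in_itv/= => /andP[cx _].
apply: cvgM; first by apply: cvgM; [exact: p_cont | exact: f_cont'].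
apply: cvgV; last by apply: cvgB; [exact: p_cont | exact: cvg_cst].
by rewrite subr_eq0 gt_eqF// powR_gt1//; lra.
Qed.

Lemma exists_minimizes_gfun (R : realType) (alpha : R) (f : R -> R) :
  0 < alpha -> {in `[1, +oo[ &, {homo f : x y / x <= y}} ->
  ~ [bounded f x | x in `[1, +oo[] -> {within `[1, +oo[, continuous f} ->
  0 < f 1 -> exists q : R, minimizes_gfun alpha f q.
Proof.
move=> alpha_gt0 f_nd f_unb f_cont f1_gt0.
have in1 (t : R) : 1 <= t -> t \in `[1, +oo[ by rewrite in_itv/= andbT.
have f_ge (t : R) : 1 <= t -> f 1 <= f t.
  by move=> t_ge1; apply: f_nd; rewrite ?in1.
pose M := gfun alpha f 2.
have M_gt0 : 0 < M.
  have p2 : 1 < 2 `^ alpha :> R by apply: powR_gt1 => //; lra.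
  have f2 : f 1 <= f 2 by apply: f_ge; lra.
  by rewrite /M /gfun divr_gt0 ?mulr_gt0//; lra.
(* Otherwise [0 < f <= M] on the whole half-line, against unboundedness. *)
have [x x_ge1 Mx] : exists2 x : R, 1 <= x & M < f x.
  apply: contrapT => nex; apply: f_unb; exists M; split; first exact: num_real.
  move=> y My x /=; rewrite in_itv/= andbT => x_ge1.
  rewrite ger0_norm; last by have := f_ge _ x_ge1; lra.
  rewrite leNgt; apply/negP => yx; apply: nex; exists x => //; lra.
(* [c0] is the point t where f(1) / (t^alpha - 1) equals [M]. For 1 < t < [c0] this quotient is
   larger than [M], and g(t) is larger still because f(t) >= f(1) and t^alpha > 1. *)
pose c0 := (1 + f 1 / M) `^ alpha^-1.
have fM_gt0 : 0 < f 1 / M by rewrite divr_gt0.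
have c0_gt1 : 1 < c0 by apply: powR_gt1; rewrite ?invr_gt0//; lra.
have c0E : c0 `^ alpha = 1 + f 1 / M.
  by rewrite -powRrM mulVf ?gt_eqF// powRr1//; lra.
(* Clipping at 2 puts 2 inside the compact interval from [c] to [d], so the minimum there is at most
   [M]; it remains to see that g >= [M] outside. *)
pose c := Num.min c0 2; pose d := Num.max x 2.
have c_gt1 : 1 < c by rewrite /c lt_min c0_gt1/=; lra.
have c_le2 : c <= 2 by rewrite /c ge_min lexx orbT.
have d_ge2 : 2 <= d by rewrite /d le_max lexx orbT.
have [q] := EVT_min (le_trans c_le2 d_ge2)
              (within_continuous_gfun _ _ _ _ _ alpha_gt0 c_gt1 f_cont).
rewrite in_itv/= => /andP[cq qd] qmin.
have qM : gfun alpha f q <= M by apply: qmin; rewrite in_itv/= c_le2.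
exists q; split; first lra.
move=> t t_gt1; have pt : 1 < t `^ alpha by exact: powR_gt1.
have pt' : 0 < t `^ alpha - 1 by lra.
have ft : f 1 <= f t by apply: f_ge; lra.
have [tc|ct] := ltP t c.
  apply: (le_trans qM); rewrite /gfun ler_pdivlMr//.
  have : t `^ alpha <= c0 `^ alpha.
    apply: ge0_ler_powR; rewrite ?nnegrE; try lra.
    by move: tc; rewrite /c lt_min => /andP[]; lra.
  rewrite c0E => pc.
  have : M * (t `^ alpha - 1) <= M * (f 1 / M).
    by rewrite ler_wpM2l//; lra.
  rewrite [M * (f 1 / M)]mulrC divfK ?gt_eqF//; nra.
have [td|dt] := leP t d; first by apply: qmin; rewrite in_itv/= ct.
apply: (le_trans qM); rewrite /gfun ler_pdivlMr//.
(* Beyond [d], the factor t^alpha / (t^alpha - 1) exceeds 1, so g(t) > f(t) >= f(x) > [M]. *)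
have : f x <= f t.
  apply: f_nd; rewrite ?in1//; first lra.
  by move: dt; rewrite /d gt_max => /andP[]; lra.
nra.
Qed.

(** With t = y / x, the weight is x^-alpha f(t) and the difference of powers is x^-alpha (1 -
    t^-alpha); their quotient f(t) / (1 - t^-alpha) is exactly g(t). *)
Lemma weight_ge_telescope (R : realType) (alpha : R) (f : R -> R) (m x y : R) :
  0 < alpha -> (forall t : R, 1 < t -> m <= gfun alpha f t) ->
  0 < x -> x < y ->
  m * (x `^ (- alpha) - y `^ (- alpha)) <= weight alpha f x y.
Proof.
move=> alpha_gt0 m_le x_gt0 xy; rewrite /weight.
have t_gt1 : 1 < y / x by rewrite ltr_pdivlMr ?mul1r.
have {1}-> : y = (y / x) * x by rewrite divfK ?gt_eqF.
set t := y / x in t_gt1 *.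
rewrite powRM; [|lra..]; rewrite !powRN.
have := m_le _ t_gt1; rewrite /gfun.
have := powR_gt1 _ _ _ alpha_gt0 t_gt1; have := powR_gt0 alpha x_gt0.
set X := x `^ alpha; set T := t `^ alpha => X_gt0 T_gt1.
rewrite ler_pdivlMr ?subr_gt0// => mT.
have -> : m * (X^-1 - T^-1 / X) = X^-1 * (m * (T - 1) / T).
  by field; rewrite ?gt_eqF//; lra.
by rewrite ler_wpM2l ?invr_ge0 ?(ltW X_gt0)// ler_pdivrMr; lra.
Qed.

Lemma seq_weight_ge_min (R : realType) (alpha : R) (f : R -> R) (q : R)
    (a : nat -> R) :
  0 < alpha -> {in `[1, +oo[ &, {homo f : x y / x <= y}} -> 0 < f 1 ->
  minimizes_gfun alpha f q -> increasing_seq a -> a 0%N = 1 ->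
  ((gfun alpha f q)%:E <= seq_weight alpha f a)%E.
Proof.
move=> alpha_gt0 f_nd f1_gt0 [q_gt1 qmin] a_inc a0.
(* [increasing_seq] is an equivalence between the two orders, hence gives strict growth. *)
have a_lt k : a k < a k.+1 by rewrite ltNge a_inc ltnn.
have a_ge1 k : 1 <= a k by rewrite -a0 a_inc.
have a_gt0 k : 0 < a k by apply: lt_le_trans (a_ge1 k).
have in1 (t : R) : 1 <= t -> t \in `[1, +oo[ by rewrite in_itv/= andbT.
(* The bound is uniform in [k]: the power is decreasing and a_k <= a_n, while the argument of [f] is
   at least 1. *)
have w_ge k n : (k < n)%N ->
    a n `^ (- alpha) * f 1 <= weight alpha f (a k) (a k.+1).
  move=> kn; have t_ge1 : 1 <= a k.+1 / a k.
    by rewrite ler_pdivlMr// mul1r ltW.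
  apply: ler_pM; rewrite ?powR_ge0 ?(ltW f1_gt0)//; last first.
    by apply: f_nd; rewrite ?in1.
  rewrite !powRN lef_pV2 ?posrE ?powR_gt0//.
  apply: ge0_ler_powR; rewrite ?nnegrE; [exact: ltW..|].
  by rewrite a_inc; apply: ltnW.
have w_ge0 k : 0 <= weight alpha f (a k) (a k.+1).
  by apply: le_trans (w_ge k k.+1 (ltnSn k)); rewrite mulr_ge0 ?powR_ge0 ?ltW.
pose S n := \sum_(0 <= k < n) weight alpha f (a k) (a k.+1).
set m := gfun alpha f q.
have S_tel n : m * (1 - a n `^ (- alpha)) <= S n.
  have -> : m * (1 - a n `^ (- alpha)) =
      \sum_(0 <= k < n) m * (a k `^ (- alpha) - a k.+1 `^ (- alpha)).
    rewrite -mulr_sumr; congr (_ * _).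
    under eq_bigr do rewrite -opprB.
    rewrite sumrN telescope_sumr// opprB a0.
    by rewrite (congr1 (@^~ (- alpha)) (powR1 R)).
  by apply: ler_sum => k _; apply: weight_ge_telescope.
have S_lin n : n%:R * (a n `^ (- alpha) * f 1) <= S n.
  rewrite mulr_natl -[n in _ *+ n]subn0 -sumr_const_nat /S !big_nat.
  by apply: ler_sum => k /andP[_ kn]; apply: w_ge.
have S_le n : ((S n)%:E <= seq_weight alpha f a)%E.
  rewrite -sumEFin; apply: nneseries_lim_ge => k _ _.
  by rewrite lee_fin.
move: S_le; case: (seq_weight alpha f a) => [s| |] S_le; last first.
- by have := S_le 0%N.
- exact: leey.
rewrite lee_fin leNgt; apply/negP => sm.
(* The empty partial sum gives [0 <= s], so the assumption [s < m] also makes [m] positive. *)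
have s_ge0 : 0 <= s by have := S_le 0%N; rewrite lee_fin /S big_geq.
pose n := Num.bound (m * s / (f 1 * (m - s))).
have fm_gt0 : 0 < f 1 * (m - s) by rewrite mulr_gt0//; lra.
have : m * s < n%:R * (f 1 * (m - s)).
  rewrite -ltr_pdivrMr//; apply: archi_boundP.
  by rewrite divr_ge0 ?(ltW fm_gt0)// mulr_ge0//; lra.
have Sn := S_le n; rewrite lee_fin in Sn.
have := le_trans (S_tel n) Sn; have := le_trans (S_lin n) Sn.
have := powR_ge0 (a n) (- alpha); have : 0 <= n%:R :> R by [].
set b := a n `^ _; set N := n%:R => N_ge0 b_ge0 lin tel.
have h1 : N * f 1 * (m - s) <= N * f 1 * (m * b).
  by rewrite ler_wpM2l ?mulr_ge0 ?(ltW f1_gt0)//; lra.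
have h2 : m * (N * (b * f 1)) <= m * s by rewrite ler_wpM2l//; lra.
lra.
Qed.

(** All consecutive ratios equal [q], so the weights form a geometric series with first term f(q)
    and ratio q^-alpha < 1. *)
Lemma seq_weight_geometric (R : realType) (alpha : R) (f : R -> R) (q : R) :
  0 < alpha -> 1 < q ->
  seq_weight alpha f (fun k : nat => q ^+ k) = (gfun alpha f q)%:E.
Proof.
move=> alpha_gt0 q_gt1; have q_gt0 : 0 < q by lra.
have Q_gt1 := powR_gt1 _ _ _ alpha_gt0 q_gt1.
set z := (q `^ alpha)^-1.
have z_lt1 : `|z| < 1.
  by rewrite ger0_norm ?invr_ge0 ?powR_ge0// invf_lt1//; lra.
have wE k : weight alpha f (q ^+ k) (q ^+ k.+1) = geometric (f q) z k.
  rewrite /weight /geometric/= exprS mulfK ?expf_neq0 ?gt_eqF// mulrC.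
  congr (_ * _); rewrite powRN -powR_mulrn ?ltW// powRAC powR_mulrn ?powR_ge0//.
  by rewrite exprVn.
rewrite /seq_weight; apply/cvg_lim => //.
have -> : gfun alpha f q = f q / (1 - z).
  by rewrite /gfun /z; field; rewrite ?gt_eqF//; lra.
under eq_fun => n do under eq_bigr => k _ do rewrite wE.
under eq_fun do rewrite sumEFin.
by apply: cvg_EFin; [exact: nearW | exact: cvg_geometric_series].
Qed.

Theorem theorem8 (R : realType) (alpha : R) (f : R -> R)
    (alpha_gt0 : 0 < alpha)
    (f_nondecreasing : {in `[1, +oo[ &, {homo f : x y / x <= y}})
    (f_unbounded : ~ [bounded f x | x in `[1, +oo[])
    (f_continuous : {within `[1, +oo[, continuous f})
    (f1_gt0 : 0 < f 1) :
  (exists q : R, minimizes_gfun alpha f q) /\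
  (forall q : R, minimizes_gfun alpha f q ->
    (forall a : nat -> R, increasing_seq a -> a 0%N = 1 ->
      ((q `^ alpha * f q / (q `^ alpha - 1))%:E <= seq_weight alpha f a)%E) /\
    seq_weight alpha f (fun k : nat => q ^+ k) =
      (q `^ alpha * f q / (q `^ alpha - 1))%:E).
Proof.
split; first exact: exists_minimizes_gfun.
move=> q qmin; split; last by apply: seq_weight_geometric => //; case: qmin.
by move=> a a_inc a0; apply: seq_weight_ge_min.
Qed.
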